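(* Let $i \in [N]$ be a given data point and let $\bm{\beta} = (\beta_0, \bm{\beta}_{\text{N}}, \bm{\beta}_{\text{C}}) \in \mathbb{R}^{1+n+k}$, $\lambda \geq 0$ and $s_i \in \mathbb{R}$ be fixed. Algorithm 2 (described in the context) identifies a most violated constraint for $i$, that is, an optimal solution of the combinatorial problem $$ \mathop{\text{maximize}}_{\bm{z} \in \mathbb{C}} \;\; \min_{u^+, v^+} \left\{ u^+ + v^+ \, : \, \begin{array}{l} (u^{+}, \, 1, \, -s_i - \lambda d_{\text{C}}(\bm{z},\bm{z}^i)) \in \mathcal{K}_{\exp}, \\ (v^{+}, \, 1, \, -y^i \bm{\beta}_{\text{N}}^\top \bm{x}^i - y^i \bm{\beta}_{\text{C}}^\top \bm{z} - y^i \beta_0 - s_i - \lambda d_{\text{C}}(\bm{z},\bm{z}^i)) \in \mathcal{K}_{\exp} \end{array} \right\}, $$ in time $\mathcal{O}(k + n + m^2)$.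
   Context: Notation: $[N] = \{1, \ldots, N\}$, $\mathbb{B} = \{0,1\}$; $\mathds{1}[\mathcal{E}]$ is $1$ if $\mathcal{E}$ holds and $0$ otherwise. $\mathbb{C} = \mathbb{C}(k_1) \times \cdots \times \mathbb{C}(k_m)$ with $\mathbb{C}(s) = \{\bm{z} \in \mathbb{B}^{s-1} : \sum_{j \in [s-1]} z_j \leq 1\}$, $k_j \geq 2$, and $k = k_1 + \cdots + k_m - m$. The data are $(\bm{x}^i, \bm{z}^i, y^i) \in \mathbb{R}^n \times \mathbb{C} \times \{-1,+1\}$, $i \in [N]$. For $p > 0$, $d_{\text{C}}(\bm{z},\bm{z}') = (\sum_{j \in [m]} \mathds{1}[\bm{z}_j \neq \bm{z}'_j])^{1/p}$, where $\bm{z} = (\bm{z}_1, \ldots, \bm{z}_m)$ with $\bm{z}_j \in \mathbb{C}(k_j)$. $\bm{\beta}_{\text{C}} = (\bm{\beta}_{\text{C},1}, \ldots, \bm{\beta}_{\text{C},m})$ with $\bm{\beta}_{\text{C},j} \in \mathbb{R}^{k_j - 1}$. $\mathcal{K}_{\exp} = \mathrm{cl}(\{(a,b,c) : a \geq b \exp(c/b), \, a > 0, \, b > 0\}) \subset \mathbb{R}^3$. Running time counts elementary operations, where arithmetic operations, comparisons and evaluations of exponentials and powers of real numbers take unit time, and each one-hot vector $\bm{z}_j$ is stored through the (known) location of its at most one nonzero entry. Algorithm 2: (1) For each $j \in \{1, \ldots, m\}$, find $\bm{z}^\star_j$ minimizing $y^i \cdot \bm{\beta}_{\text{C},j}^\top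 \bm{z}_j$ across all $\bm{z}_j \in \mathbb{C}(k_j) \setminus \{\bm{z}^i_j\}$. (2) Let $\pi : [m] \to [m]$ be an ordering such that $y^i \cdot \bm{\beta}_{\text{C},\pi(j)}^\top (\bm{z}^\star_{\pi(j)} - \bm{z}^i_{\pi(j)}) \leq y^i \cdot \bm{\beta}_{\text{C},\pi(j')}^\top (\bm{z}^\star_{\pi(j')} - \bm{z}^i_{\pi(j')})$ for all $1 \leq j \leq j' \leq m$. (3) Set $\mathcal{W} = \emptyset$; for each $\delta \in \{0, 1, \ldots, m\}$, add to $\mathcal{W}$ the vector $\bm{z}$ with $\bm{z}_j = \bm{z}^\star_j$ if $\pi^{-1}(j) \leq \delta$ (i.e., $j \in \{\pi(1), \ldots, \pi(\delta)\}$) and $\bm{z}_j = \bm{z}^i_j$ otherwise. (4) Output an element $\bm{z}$ of $\mathcal{W}$ with the largest value of $$ \min_{u^+, v^+} \left\{ u^+ + v^+ \, : \, \begin{array}{l} (u^{+}, \, 1, \, -s_i - \lambda d_{\text{C}}(\bm{z},\bm{z}^i)) \in \mathcal{K}_{\exp}, \\ (v^{+}, \, 1, \, -y^i \bm{\beta}_{\text{N}}^\top \bm{x}^i - y^i \bm{\beta}_{\text{C}}^\top \bm{z} - y^i \beta_0 - s_i - \lambda d_{\text{C}}(\bm{z},\bm{z}^i)) \in \mathcal{K}_{\exp} \end{array} \right\} $$ (the most violated constraint in the candidate set $\mathcal{W}$). *)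

(* Defs.v *)
From HB Require Import structures.
From mathcomp Require Import all_boot all_order all_algebra all_fingroup.
From mathcomp Require Import all_classical all_reals all_analysis.

Set Implicit Arguments.
Unset Strict Implicit.
Unset Printing Implicit Defensive.

Import Order.TTheory GRing.Theory Num.Theory.
Import numFieldNormedType.Exports.
Local Open Scope classical_set_scope.
Local Open Scope ring_scope.

Definition K_exp (R : realType) : set (R * R * R) :=
  closure [set t | [/\ t.1.1 >= t.1.2 * expR (t.2 / t.1.2),
                       0 < t.1.1 & 0 < t.1.2]].

(* Members of {0,1}^(s-1); the bound on the sum is in [onehot]. *)
Definition catblock (s : nat) := {ffun 'I_s.-1 -> bool}.

Definition onehot (s : nat) : set (catblock s) :=
  [set z : catblock s | (\sum_(l < s.-1) z l <= 1)%N].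

Definition catvec (m : nat) (k : 'I_m -> nat) := forall j : 'I_m, catblock (k j).

Definition CC (m : nat) (k : 'I_m -> nat) : set (catvec k) :=
  [set z : catvec k | forall j, onehot (z j)].

(* k_1 + ... + k_m - m *)
Definition ktot (m : nat) (k : 'I_m -> nat) : nat := (\sum_j k j - m)%N.

Definition dC (R : realType) (m : nat) (k : 'I_m -> nat) (p : R)
    (z z' : catvec k) : R :=
  (\sum_(j < m) (z j != z' j)%:R) `^ (1 / p).

Record subproblem (R : realType) (n m : nat) (k : 'I_m -> nat) := Subproblem {
  sp_x : 'rV[R]_n;
  sp_z : catvec k;
  sp_y : R;
  sp_beta0 : R;
  sp_betaN : 'rV[R]_n;
  sp_betaC : forall j : 'I_m, 'rV[R]_(k j).-1;
  sp_lambda : R;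
  sp_s : R;
  sp_p : R
}.

Section Pricing.
Context (R : realType) (n m : nat) (k : 'I_m -> nat).
Implicit Types (I : subproblem R n k) (z : catvec k).

Definition dotC I (j : 'I_m) (zj : catblock (k j)) : R :=
  \sum_(l < (k j).-1) sp_betaC I j 0 l * (zj l)%:R.

Definition dotN I : R := \sum_(l < n) sp_betaN I 0 l * sp_x I 0 l.

Definition inner_values I z : set R :=
  [set t | exists uv : R * R, [/\ t = uv.1 + uv.2,
     K_exp (uv.1, 1, - sp_s I - sp_lambda I * dC (sp_p I) z (sp_z I)) &
     K_exp (uv.2, 1, - sp_y I * dotN I
                     - sp_y I * (\sum_(j < m) dotC I (z j))
                     - sp_y I * sp_beta0 I
                     - sp_s I - sp_lambda I * dC (sp_p I) z (sp_z I))]].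

Definition is_minimum (A : set R) (v : R) : Prop := A v /\ lbound A v.

(* [z] maximizes over [D] the minimum of [inner_values]; that the minima are
   attained is part of the claim. *)
Definition most_violated_in I (D : set (catvec k)) z : Prop :=
  D z /\ exists2 v, is_minimum (inner_values I z) v &
    forall z', D z' ->
      exists2 v', is_minimum (inner_values I z') v' & v' <= v.

Definition step1 I (zstar : catvec k) : Prop :=
  forall j : 'I_m,
    let cands := [set zj : catblock (k j) | onehot zj /\ zj <> sp_z I j] in
    cands (zstar j) /\
    forall zj, cands zj ->
      sp_y I * dotC I (zstar j) <= sp_y I * dotC I zj.

Definition step2 I (zstar : catvec k) (pi : {perm 'I_m}) : Prop :=
  let gain j := sp_y I * (dotC I (zstar j) - dotC I (sp_z I j)) in
  forall j j' : 'I_m, (j <= j')%N -> gain (pi j) <= gain (pi j').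

(* Positions are counted from 0, so that "pi^-1(j) <= delta" for positions
   counted from 1 becomes a strict inequality. *)
Definition step3 I (zstar : catvec k) (pi : {perm 'I_m}) : set (catvec k) :=
  [set z | exists2 delta : nat, (delta <= m)%N &
     forall j : 'I_m,
       z j = if ((pi^-1)%g j < delta)%N then zstar j else sp_z I j].

Definition greedy_run I (zstar : catvec k) (pi : {perm 'I_m}) z : Prop :=
  [/\ step1 I zstar, step2 I zstar pi &
      most_violated_in I (step3 I zstar pi) z].

End Pricing.

(* A real random-access machine. A program is a syntactic object that refers
   neither to the instance nor to its dimensions. Memory consists of arrays of
   naturals and arrays of reals; scalars live in cell 0 of an array. Index
   arithmetic is limited to addition and truncated subtraction, and there is no
   conversion from reals to naturals. Loops are bounded (the bound is evaluated
   on entry), so that every program halts and its running time is a function of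
   the initial memory. *)
Inductive iexp :=
  | IConst of nat
  | IGet of nat & iexp
  | IAdd of iexp & iexp
  | ISub of iexp & iexp.

Inductive rexp :=
  | RConst of nat
  | RGet of nat & iexp
  | RAdd of rexp & rexp
  | RSub of rexp & rexp
  | RMul of rexp & rexp
  | RDiv of rexp & rexp
  | RExp of rexp
  | RPow of rexp & rexp.

Inductive bexp :=
  | ILe of iexp & iexp
  | RLe of rexp & rexp
  | BNot of bexp
  | BAnd of bexp & bexp.

Inductive cmd :=
  | Skip
  | ISet of nat & iexp & iexp
  | RSet of nat & iexp & rexp
  | Seq of cmd & cmd
  | If of bexp & cmd & cmd
  | For of nat & iexp & cmd.

Record store (R : realType) := Store {
  imem : nat -> nat -> nat;
  rmem : nat -> nat -> R
}.

Section Machine.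
Context (R : realType).
Implicit Types (s : store R).

Definition upd (T : Type) (mem : nat -> nat -> T) (a i : nat) (v : T) :=
  fun a' i' => if (a' == a) && (i' == i) then v else mem a' i'.

Definition iset s a i v := Store (upd (imem s) a i v) (rmem s).
Definition rset s a i v := Store (imem s) (upd (rmem s) a i v).

Fixpoint ieval s (e : iexp) : nat :=
  match e with
  | IConst c => c
  | IGet a e1 => imem s a (ieval s e1)
  | IAdd e1 e2 => (ieval s e1 + ieval s e2)%N
  | ISub e1 e2 => (ieval s e1 - ieval s e2)%N
  end.

Fixpoint reval s (e : rexp) : R :=
  match e with
  | RConst c => c%:R
  | RGet a e1 => rmem s a (ieval s e1)
  | RAdd e1 e2 => reval s e1 + reval s e2
  | RSub e1 e2 => reval s e1 - reval s e2
  | RMul e1 e2 => reval s e1 * reval s e2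
  | RDiv e1 e2 => reval s e1 / reval s e2
  | RExp e1 => expR (reval s e1)
  | RPow e1 e2 => reval s e1 `^ reval s e2
  end.

Fixpoint beval s (b : bexp) : bool :=
  match b with
  | ILe e1 e2 => (ieval s e1 <= ieval s e2)%N
  | RLe e1 e2 => reval s e1 <= reval s e2
  | BNot b1 => ~~ beval s b1
  | BAnd b1 b2 => beval s b1 && beval s b2
  end.

(* Unit cost for every constructor, memory accesses included. *)
Fixpoint icost (e : iexp) : nat :=
  match e with
  | IConst _ => 1
  | IGet _ e1 => (icost e1).+1
  | IAdd e1 e2 | ISub e1 e2 => (icost e1 + icost e2).+1
  end.

Fixpoint rcost (e : rexp) : nat :=
  match e with
  | RConst _ => 1
  | RGet _ e1 => (icost e1).+1
  | RAdd e1 e2 | RSub e1 e2 | RMul e1 e2 | RDiv e1 e2 | RPow e1 e2 =>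
      (rcost e1 + rcost e2).+1
  | RExp e1 => (rcost e1).+1
  end.

Fixpoint bcost (b : bexp) : nat :=
  match b with
  | ILe e1 e2 => (icost e1 + icost e2).+1
  | RLe e1 e2 => (rcost e1 + rcost e2).+1
  | BNot b1 => (bcost b1).+1
  | BAnd b1 b2 => (bcost b1 + bcost b2).+1
  end.

(* Final memory and number of elementary operations. [For a e c] runs [c] with
   0, 1, ..., e-1 successively written to cell 0 of the array [a]. *)
Fixpoint exec (c : cmd) s : store R * nat :=
  match c with
  | Skip => (s, 1%N)
  | ISet a e1 e2 =>
      (iset s a (ieval s e1) (ieval s e2), (icost e1 + icost e2).+1)
  | RSet a e1 e2 =>
      (rset s a (ieval s e1) (reval s e2), (icost e1 + rcost e2).+1)
  | Seq c1 c2 =>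
      let r1 := exec c1 s in
      let r2 := exec c2 r1.1 in
      (r2.1, (r1.2 + r2.2)%N)
  | If b c1 c2 =>
      let r := exec (if beval s b then c1 else c2) s in
      (r.1, (bcost b + r.2).+1)
  | For a e c1 =>
      foldl (fun st i => let r := exec c1 (iset st.1 a 0 i) in
                         (r.1, (st.2 + r.2).+1))
            (s, (icost e).+1) (iota 0 (ieval s e))
  end.

End Machine.

(* Location of the nonzero entry: 0 for the zero vector, l+1 for the unit
   vector with entry l nonzero (injective on one-hot vectors). *)
Definition loc (s : nat) (z : catblock s) : nat :=
  if [pick l | z l] is Some l then l.+1 else 0%N.

(* Arrays of naturals and arrays of reals are numbered separately. *)
Definition a_n := 0%N.
Definition a_m := 1%N.
Definition a_k := 2%N.
Definition a_z := 3%N.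
Definition a_zstar := 4%N.
Definition a_pi := 5%N.
Definition a_out := 6%N.

Definition a_x := 0%N.
Definition a_y := 1%N.
Definition a_beta0 := 2%N.
Definition a_betaN := 3%N.
Definition a_betaC := 4%N.
Definition a_lambda := 5%N.
Definition a_s := 6%N.
Definition a_p := 7%N.

(* The blocks of beta_C are stored consecutively, as one vector of length
   [ktot k]. Cells that hold no input are arbitrary. *)
Definition holds_input (R : realType) (n m : nat) (k : 'I_m -> nat)
    (I : subproblem R n k) (s : store R) : Prop :=
  [/\ [/\ imem s a_n 0 = n, imem s a_m 0 = m,
          forall j : 'I_m, imem s a_k j = k j &
          forall j : 'I_m, imem s a_z j = loc (sp_z I j)],
      [/\ forall l : 'I_n, rmem s a_x l = sp_x I 0 l,
          forall l : 'I_n, rmem s a_betaN l = sp_betaN I 0 l &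
          forall (j : 'I_m) (l : 'I_(k j).-1),
            rmem s a_betaC (\sum_(j' < m | (j' < j)%N) (k j').-1 + l)%N
            = sp_betaC I j 0 l] &
      [/\ rmem s a_y 0 = sp_y I, rmem s a_beta0 0 = sp_beta0 I,
          rmem s a_lambda 0 = sp_lambda I, rmem s a_s 0 = sp_s I &
          rmem s a_p 0 = sp_p I]].

Definition holds_run (m : nat) (k : 'I_m -> nat) (R : realType) (s : store R)
    (zstar : catvec k) (pi : {perm 'I_m}) (z : catvec k) : Prop :=
  forall j : 'I_m,
    [/\ imem s a_zstar j = loc (zstar j), imem s a_pi j = pi j &
        imem s a_out j = loc (z j)].

(* [c] implements the greedy algorithm on [I]: started from any memory holding the
   input, it ends with a record of one of its runs, within [T] operations. *)
Definition implements_within (c : cmd) (R : realType) (n m : nat)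
    (k : 'I_m -> nat) (I : subproblem R n k) (T : nat) : Prop :=
  forall s : store R, holds_input I s ->
    (exists (zstar : catvec k) (pi : {perm 'I_m}) (z : catvec k),
       greedy_run I zstar pi z /\ holds_run (exec c s).1 zstar pi z) /\
    ((exec c s).2 <= T)%N.

(* Main.v *)
(** The inner minimum equals exp(-s - lambda d) + exp(-s - lambda d - C - t) with
    t = y * beta_C^T z and C independent of z, because (a, 1, c) belongs to K_exp
    exactly when exp(c) <= a. The distance d depends only on the number h of
    blocks in which z differs from z^i, so for a given h the best z minimizes t:
    its h switched blocks should be those with the smallest gains, each switched
    to its best alternative. These vectors are the candidates of Algorithm 2.

    The machine sorts the gains in O(m^2) by computing, for every block, the
    number of blocks that precede it, and then evaluates each of the m + 1
    candidates from scratch in O(m). *)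

Require Import Defs.
From HB Require Import structures.
From mathcomp Require Import all_boot all_order all_algebra all_fingroup.
From mathcomp Require Import all_classical all_reals all_analysis.
From mathcomp Require Import zify ring.

Set Implicit Arguments.
Unset Strict Implicit.
Unset Printing Implicit Defensive.

Import Order.TTheory GRing.Theory Num.Theory.
Import numFieldNormedType.Exports.
Local Open Scope classical_set_scope.
Local Open Scope ring_scope.

(** * Optimality of the candidates *)

(** Optimality is proved for every run, whatever the choices among ties, so it is stated with
    relations on [catvec] and permutations and never mentions the machine. The machine knows only
    locations and ranks. The two levels meet where the final memory is decoded: locations become
    one-hot blocks, ranks become the inverse of a permutation. The term linear in k comes from a
    single pass over the stored coefficients, which saves for each block its contribution at the
    best alternative and at the data point; evaluating a candidate then reads one number per block.
    The main obstacle is framing: memory outside the input is arbitrary and each phase relies on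
    cells left by earlier ones. The arrays that a command may write are read off its syntax, so such
    claims reduce to computation, and the loop rules pass them to every iteration; an invariant then
    describes only modified cells. Likewise the cost of loop-free code is bounded by a number
    computed from its syntax. *)

Lemma K_exp1 (R : realType) (a c : R) : K_exp (a, 1, c) <-> expR c <= a.
Proof.
split=> [clac|lea]; last first.
  apply: subset_closure; split => //=; first by rewrite mul1r divr1.
  exact: lt_le_trans (expR_gt0 c) lea.
rewrite leNgt; apply/negP => ltac.
(* [f] measures the violation of the defining inequality. It is continuous near second coordinate 1,
   so a positive value at the point spreads to a neighbourhood, which must nevertheless meet the
   generating set, where [f] is at most 0. *)
pose f (t : R * R * R) := t.1.2 * expR (t.2 / t.1.2) - t.1.1.
have f_cvg : f @ nbhs ((a, 1, c) : R * R * R) --> f (a, 1, c).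
  have h1 : (fun t : R * R * R => t.1) @ nbhs ((a, 1, c) : R * R * R)
      --> ((a, 1) : R * R).
    exact: cvg_fst.
  have h11 : (fun t : R * R * R => t.1.1) @ nbhs ((a, 1, c) : R * R * R) --> a.
    by apply: (cvg_comp fst fst h1); exact: cvg_fst.
  have h12 : (fun t : R * R * R => t.1.2) @ nbhs ((a, 1, c) : R * R * R) --> (1 : R).
    by apply: (cvg_comp fst snd h1); exact: cvg_snd.
  have h2 : (fun t : R * R * R => t.2) @ nbhs ((a, 1, c) : R * R * R) --> c.
    exact: cvg_snd.
  have hq : (fun t : R * R * R => t.2 / t.1.2) @ nbhs ((a, 1, c) : R * R * R)
      --> c / 1.
    by apply: cvgM h2 _; apply: cvgV h12; rewrite oner_neq0.
  apply: cvgB h11; apply: cvgM h12 _.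
  by apply: (cvg_comp _ (@expR R) hq); exact: continuous_expR.
have f_gt0 : 0 < f (a, 1, c) by rewrite /f /= mul1r divr1 subr_gt0.
have /clac [t [[/= lef _ _]]] : nbhs ((a, 1, c) : R * R * R) [set t | 0 < f t].
  exact: (cvgr_gt _ f_cvg).
by rewrite /f /= subr_gt0 ltNge lef.
Qed.

Definition inner_min (R : realType) (n m : nat) (k : 'I_m -> nat)
    (I : subproblem R n k) (z : catvec k) : R :=
  expR (- sp_s I - sp_lambda I * dC (sp_p I) z (sp_z I)) +
  expR (- sp_y I * dotN I - sp_y I * (\sum_(j < m) dotC I (z j))
        - sp_y I * sp_beta0 I - sp_s I
        - sp_lambda I * dC (sp_p I) z (sp_z I)).

Lemma inner_minP (R : realType) (n m : nat) (k : 'I_m -> nat)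
    (I : subproblem R n k) (z : catvec k) :
  is_minimum (inner_values I z) (inner_min I z).
Proof.
split=> [|_ [[u v] /= [-> /K_exp1 leu /K_exp1 lev]]]; last exact: lerD.
by eexists (_, _); split; [reflexivity | apply/K_exp1 | apply/K_exp1].
Qed.

(** A minimum is unique when it exists, and [inner_minP] provides one for every [z], so the
    existential form collapses to a comparison of closed forms. *)
Lemma most_violated_inE (R : realType) (n m : nat) (k : 'I_m -> nat)
    (I : subproblem R n k) (D : set (catvec k)) (z : catvec k) :
  most_violated_in I D z <->
  D z /\ forall z', D z' -> inner_min I z' <= inner_min I z.
Proof.
have minU z0 v : is_minimum (inner_values I z0) v -> v = inner_min I z0.
  have [in0 lb0] := inner_minP I z0; move=> [inv lbv].
  by apply/le_anti; rewrite lbv // lb0.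
split=> [[Dz [v minv maxz]]|[Dz maxz]]; (split; first exact: Dz).
  move=> z' Dz'; have [v' minv' lev] := maxz z' Dz'.
  by rewrite -(minU z' v' minv') -(minU z v minv).
exists (inner_min I z); first exact: inner_minP.
move=> z' Dz'; exists (inner_min I z'); first exact: inner_minP.
exact: maxz.
Qed.

(* Subtracting from [g] a value separating the first [#|T|] positions from
   the others makes the comparison hold term by term. *)
Lemma sum_initial_le (R : realDomainType) (m : nat) (g : 'I_m -> R)
    (T : {set 'I_m}) :
  (forall i j : 'I_m, (i <= j)%N -> g i <= g j) ->
  \sum_(i < m | (i < #|T|)%N) g i <= \sum_(i in T) g i.
Proof.
move=> gmono; set h := #|T|.
have hm : (h <= m)%N by rewrite -[m]card_ord max_card.
(* The separating value is [g] at position [h - 1]; if [h] is 0 the least value [g 0] serves, and if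
   [m] is 0 there is nothing to separate. *)
have [c cP] : exists c, forall i : 'I_m, if (i < h)%N then g i <= c else c <= g i.
  case: (posnP m) => [m0|m_gt0].
    by exists 0 => i; have := leq_trans (ltn_ord i) (eq_leq m0).
  have [h0|h_gt0] := posnP h.
    exists (g (Ordinal m_gt0)) => i; rewrite h0 /=.
    exact: gmono.
  have h1m : (h.-1 < m)%N by rewrite prednK.
  exists (g (Ordinal h1m)) => i; case: ltnP => hi; apply: gmono => /=.
    by rewrite -ltnS prednK.
  by apply: leq_trans hi; rewrite leq_pred.
(* Both sums have [h] terms, so shifting by [c] changes them equally. *)
have sum_c : \sum_(i < m | (i < h)%N) c = \sum_(i in T) c.
  by rewrite (big_ord_narrow hm) /= !sumr_const card_ord.
rewrite -(lerD2r (- \sum_(i in T) c)) -{1}sum_c -!sumrB.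
rewrite big_mkcond [leRHS]big_mkcond; apply: ler_sum => i _ /=.
have := cP i; case: ltnP => _ ci; case: ifP => _ //.
  by rewrite subr_le0.
by rewrite subr_ge0.
Qed.

Lemma step3_CC (R : realType) (n m : nat) (k : 'I_m -> nat)
    (I : subproblem R n k) (zstar : catvec k) (pi : {perm 'I_m}) (z : catvec k) :
  CC (sp_z I) -> CC zstar -> step3 I zstar pi z -> CC z.
Proof. by move=> Cz Cs [delta _ zE] j; rewrite zE; case: ifP. Qed.

(* Among the vectors at a fixed Hamming distance from [sp_z I], the objective
   is a decreasing function of [sp_y I * \sum_j dotC I (z j)]. *)
Lemma step3_dominates (R : realType) (n m : nat) (k : 'I_m -> nat)
    (I : subproblem R n k) (zstar : catvec k) (pi : {perm 'I_m}) (z' : catvec k) :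
  step1 I zstar -> step2 I zstar pi -> CC z' ->
  exists2 z, step3 I zstar pi z & inner_min I z' <= inner_min I z.
Proof.
move=> st1 st2 Cz'.
(* The dominating candidate switches as many blocks as [z'] does, so its [delta] is [#|T|]. *)
pose T := [set j | z' j != sp_z I j]%SET.
pose gain j := sp_y I * (dotC I (zstar j) - dotC I (sp_z I j)).
pose z : catvec k := fun j =>
  if ((pi^-1)%g j < #|T|)%N then zstar j else sp_z I j.
have hT : (#|T| <= m)%N by rewrite -[m in leqRHS]card_ord max_card.
exists z; first by exists #|T|.
have zstarN j : zstar j != sp_z I j by apply/eqP; case: (st1 j) => -[].
have reidx (V : nmodType) (F : 'I_m -> V) :
    \sum_(j < m | ((pi^-1)%g j < #|T|)%N) F j
    = \sum_(i < m | (i < #|T|)%N) F (pi i).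
  by rewrite (reindex_inj (@perm_inj _ pi)); apply: eq_bigl => i; rewrite permK.
have dE : dC (sp_p I) z' (sp_z I) = dC (sp_p I) z (sp_z I).
  rewrite /dC -!natr_sum -!big_mkcond /=; congr (_%:R `^ _).
  transitivity #|T|.
    by rewrite -sum1_card; apply: eq_bigl => j; rewrite inE.
  transitivity (\sum_(j < m | ((pi^-1)%g j < #|T|)%N) 1)%N.
    by rewrite reidx (big_ord_narrow hT) /= sum1_card card_ord.
  by apply: eq_bigl => j; rewrite /z; case: ifP => _; rewrite ?zstarN ?eqxx.
suff le_dot : sp_y I * (\sum_(j < m) dotC I (z j))
             <= sp_y I * (\sum_(j < m) dotC I (z' j)).
  by rewrite /inner_min dE lerD2l ler_expR !lerD2r lerD2l lerN2.
(* Measured from the value at [sp_z I], both sides become sums over switched blocks only. *)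
rewrite -subr_ge0 -mulrBr.
rewrite -(subrKA (\sum_(j < m) dotC I (sp_z I j))) mulrDr.
rewrite -[X in _ + _ * X]opprB mulrN subr_ge0 -!sumrB !mulr_sumr.
(* Intermediate point: the blocks that [z'] switches, each moved to its best alternative. Step 1
   compares it with [z']; the ordering of step 2 compares it with [z]. *)
apply: (@le_trans _ _ (\sum_(j in T) gain j)); last first.
  rewrite big_mkcond; apply: ler_sum => j _; rewrite inE.
  case: eqP => [->|/= z'N]; first by rewrite subrr mulr0.
  rewrite /gain !mulrBr lerD2r; case: (st1 j) => _ /(_ (z' j)); apply.
  by split; first exact: Cz'.
have -> : \sum_(i < m) sp_y I * (dotC I (z i) - dotC I (sp_z I i))
    = \sum_(i < m | (i < #|T|)%N) gain (pi i).
  rewrite -reidx [RHS]big_mkcond; apply: eq_bigr => j _.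
  by rewrite /z; case: ifP => // _; rewrite subrr mulr0.
have -> : \sum_(j in T) gain j = \sum_(i in (pi @^-1: T)%SET) gain (pi i).
  by rewrite (reindex_inj (@perm_inj _ pi)); apply: eq_bigl => i; rewrite [RHS]inE.
have <- : #|(pi @^-1: T)%SET| = #|T|.
  by apply: card_preimset; exact: perm_inj.
exact: sum_initial_le st2.
Qed.

Lemma greedy_run_optimal (R : realType) (n m : nat) (k : 'I_m -> nat)
    (I : subproblem R n k) (zstar : catvec k) (pi : {perm 'I_m}) (z : catvec k) :
  CC (sp_z I) -> greedy_run I zstar pi z -> most_violated_in I (@CC m k) z.
Proof.
move=> Cz [st1 st2 /most_violated_inE [st3 maxz]]; apply/most_violated_inE; split.
  by apply: step3_CC st3 => // j; case: (st1 j) => -[].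
move=> z' Cz'; have [z1 st3z1 le1] := step3_dominates st1 st2 Cz'.
exact: le_trans le1 (maxz z1 st3z1).
Qed.

(** * Loops of the random-access machine *)

Definition run (R : realType) (c : cmd) (s : store R) : store R := (exec c s).1.
Definition cost (R : realType) (c : cmd) (s : store R) : nat := (exec c s).2.

(** A syntactic superset of the arrays written, loop counters included; for a concrete program,
    membership is decided by computation. *)
Fixpoint iwrites (c : cmd) : seq nat :=
  match c with
  | Skip | RSet _ _ _ => [::]
  | ISet a _ _ => [:: a]
  | Seq c1 c2 | If _ c1 c2 => iwrites c1 ++ iwrites c2
  | For a _ c1 => a :: iwrites c1
  end.

Fixpoint rwrites (c : cmd) : seq nat :=
  match c with
  | Skip | ISet _ _ _ => [::]
  | RSet a _ _ => [:: a]
  | Seq c1 c2 | If _ c1 c2 => rwrites c1 ++ rwrites c2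
  | For _ _ c1 => rwrites c1
  end.

(** The second store need not be the result of running [c]: inside a loop, the intermediate stores
    are also compared with the entry store. *)
Definition unchanged (R : realType) (c : cmd) (s s' : store R) : Prop :=
  (forall a i, a \notin iwrites c -> imem s' a i = imem s a i) /\
  (forall a i, a \notin rwrites c -> rmem s' a i = rmem s a i).

Lemma updN (T : Type) (mem : nat -> nat -> T) (a i : nat) (v : T) (a' i' : nat) :
  a' != a -> upd mem a i v a' i' = mem a' i'.
Proof. by rewrite /upd => /negPf ->. Qed.

Section Loops.
Context (R : realType).
Implicit Types (s : store R) (c : cmd).

Lemma run_seq c1 c2 s : run (Seq c1 c2) s = run c2 (run c1 s).
Proof. by []. Qed.

Lemma run_if b c1 c2 s : run (If b c1 c2) s = run (if beval s b then c1 else c2) s.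
Proof. by []. Qed.

Lemma run_iset a e1 e2 s : run (ISet a e1 e2) s = iset s a (ieval s e1) (ieval s e2).
Proof. by []. Qed.

Lemma run_rset a e1 e2 s : run (RSet a e1 e2) s = rset s a (ieval s e1) (reval s e2).
Proof. by []. Qed.

Lemma run_skip s : run Skip s = s.
Proof. by []. Qed.

Lemma for_ind (P : nat -> store R * nat -> Prop) a e c s :
  P 0 (s, (icost e).+1) ->
  (forall i st, (i < ieval s e)%N -> P i st ->
     P i.+1 (run c (iset st.1 a 0 i), (st.2 + cost c (iset st.1 a 0 i)).+1)) ->
  P (ieval s e) (exec (For a e c) s).
Proof.
(* The claim is generalised to the first [q] iterations, with [q] at most the bound evaluated on
   entry; the last iteration is then split off the [foldl]. *)
move=> P0 PS /=; elim: {1 3 4}(ieval s e) (leqnn (ieval s e)) => [//|q IHq] leq_q.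
have -> : iota 0 q.+1 = rcons (iota 0 q) q by rewrite -addn1 iotaD cats1.
rewrite foldl_rcons.
by apply: PS => //; apply: IHq; exact: ltnW.
Qed.

Lemma unchanged_for a e c s s1 s2 i :
  unchanged (For a e c) s s1 -> unchanged c (iset s1 a 0 i) s2 ->
  unchanged (For a e c) s s2.
Proof.
move=> [i1 r1] [i2 r2]; split=> a' i' /=; last by move=> ?; rewrite r2 // r1.
rewrite inE negb_or => /andP[neq nin].
by rewrite i2 //= updN // i1 // inE negb_or neq.
Qed.

Lemma unchanged_run c s : unchanged c s (run c s).
Proof.
elim: c s => [//|a e1 e2|a e1 e2|c1 IH1 c2 IH2|b c1 IH1 c2 IH2|a e c IHc] s.
- by split=> // a' i; rewrite inE => neq; rewrite /= updN.
- by split=> // a' i; rewrite inE => neq; rewrite /= updN.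
- rewrite run_seq; have [i1 r1] := IH1 s; have [i2 r2] := IH2 (run c1 s).
  split=> a i /=; rewrite mem_cat negb_or => /andP[n1 n2].
    by rewrite i2 ?i1.
  by rewrite r2 ?r1.
- rewrite run_if; case: (beval s b); [have [i1 r1] := IH1 s | have [i1 r1] := IH2 s];
  by split=> a i /=; rewrite mem_cat negb_or => /andP[n1 n2]; rewrite ?i1 ?r1.
- apply: (@for_ind (fun=> fun st => unchanged (For a e c) s st.1)) => //.
  by move=> i st _ un; apply: unchanged_for un _; exact: IHc.
Qed.

(** Invariant rule with the frame condition supplied for free, so that [P] can ignore everything the
    loop does not write. *)
Lemma run_for (P : nat -> store R -> Prop) a e c s :
  P 0 s ->
  (forall i s', (i < ieval s e)%N -> unchanged (For a e c) s s' -> P i s' ->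
     P i.+1 (run c (iset s' a 0 i))) ->
  P (ieval s e) (run (For a e c) s).
Proof.
move=> P0 PS.
suff [] : P (ieval s e) (run (For a e c) s) /\
          unchanged (For a e c) s (run (For a e c) s) by [].
apply: (@for_ind (fun i st => P i st.1 /\ unchanged (For a e c) s st.1)) => //.
move=> i st lti [Pi un]; split; first exact: PS.
by apply: unchanged_for un _; exact: unchanged_run.
Qed.

Lemma cost_for (T : nat -> nat) a e c s :
  (forall i s', (i < ieval s e)%N -> unchanged (For a e c) s s' ->
     (cost c (iset s' a 0 i) <= T i)%N) ->
  (cost (For a e c) s <= (icost e).+1 + \sum_(i < ieval s e) (T i).+1)%N.
Proof.
move=> leT.
suff [] : (cost (For a e c) s <= (icost e).+1 + \sum_(i < ieval s e) (T i).+1)%N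
          /\ unchanged (For a e c) s (run (For a e c) s) by [].
apply: (@for_ind (fun i st => (st.2 <= (icost e).+1 + \sum_(j < i) (T j).+1)%N
                              /\ unchanged (For a e c) s st.1)).
  by rewrite big_ord0 addn0.
move=> i st lti [le_st un]; split.
  by rewrite big_ord_recr /= addnA addnS ltnS leq_add // leT.
by apply: unchanged_for un _; exact: unchanged_run.
Qed.

End Loops.

(** * The program and its correctness *)

Definition b_j := 7%N.
Definition b_l := 8%N.
Definition b_off := 9%N.
Definition b_rank := 10%N.
Definition b_delta := 11%N.
Definition b_best := 12%N.

(* [b_vstar] and [b_v] hold, for each block, its contribution to
   [y * beta_C^T z] at [zstar] and at [sp_z I]; [b_h] counts the switched blocks. *)
Definition b_vstar := 8%N.
Definition b_v := 9%N.
Definition b_dotN := 10%N.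
Definition b_t := 11%N.
Definition b_h := 12%N.
Definition b_val := 13%N.
Definition b_bestval := 14%N.

Definition ivar (a : nat) : iexp := IGet a (IConst 0).
Definition rvar (a : nat) : rexp := RGet a (IConst 0).
Definition isucc (e : iexp) : iexp := IAdd e (IConst 1).

Definition entry (e : iexp) : rexp :=
  RMul (rvar a_y) (RGet a_betaC (IAdd (ivar b_off) e)).

(** The scan must start from an admissible alternative: the zero vector (location 0), or location 1
    if the data point itself has the zero vector. Location 1 exists because [2 <= k j]. *)
Definition init_block : cmd :=
  If (ILe (IGet a_z (ivar b_j)) (IConst 0))
    (Seq (ISet a_zstar (ivar b_j) (IConst 1))
    (Seq (RSet b_vstar (ivar b_j) (entry (IConst 0)))
         (RSet b_v (ivar b_j) (RConst 0))))
    (Seq (ISet a_zstar (ivar b_j) (IConst 0))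
    (Seq (RSet b_vstar (ivar b_j) (RConst 0))
         (RSet b_v (ivar b_j)
            (entry (ISub (IGet a_z (ivar b_j)) (IConst 1)))))).

(** The language compares only by [<=]: the inner conjunction expresses equality with the forbidden
    location, and the negated comparison a strict improvement. *)
Definition scan_block : cmd :=
  For b_l (ISub (IGet a_k (ivar b_j)) (IConst 1))
    (If (BAnd (BNot (BAnd (ILe (IGet a_z (ivar b_j)) (isucc (ivar b_l)))
                          (ILe (isucc (ivar b_l)) (IGet a_z (ivar b_j)))))
              (BNot (RLe (RGet b_vstar (ivar b_j)) (entry (ivar b_l)))))
       (Seq (ISet a_zstar (ivar b_j) (isucc (ivar b_l)))
            (RSet b_vstar (ivar b_j) (entry (ivar b_l))))
       Skip).

Definition next_block : cmd :=
  ISet b_off (IConst 0)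
    (IAdd (ivar b_off) (ISub (IGet a_k (ivar b_j)) (IConst 1))).

Definition find_zstar : cmd :=
  Seq (ISet b_off (IConst 0) (IConst 0))
      (For b_j (ivar a_m) (Seq init_block (Seq scan_block next_block))).

Definition gain_at (e : iexp) : rexp := RSub (RGet b_vstar e) (RGet b_v e).

Definition count_before : cmd :=
  For b_l (ivar a_m)
    (If (BAnd (RLe (gain_at (ivar b_l)) (gain_at (ivar b_j)))
              (BNot (BAnd (RLe (gain_at (ivar b_j)) (gain_at (ivar b_l)))
                          (ILe (ivar b_j) (ivar b_l)))))
       (ISet b_rank (ivar b_j) (isucc (IGet b_rank (ivar b_j))))
       Skip).

(** The array [b_rank] is the inverse of the ordering recorded in [a_pi]; deciding whether a
    candidate switches a block needs only [b_rank]. *)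
Definition sort_gains : cmd :=
  For b_j (ivar a_m)
    (Seq (ISet b_rank (ivar b_j) (IConst 0))
    (Seq count_before
         (ISet a_pi (IGet b_rank (ivar b_j)) (ivar b_j)))).

Definition compute_dotN : cmd :=
  Seq (RSet b_dotN (IConst 0) (RConst 0))
      (For b_l (ivar a_n)
         (RSet b_dotN (IConst 0)
            (RAdd (rvar b_dotN)
                  (RMul (RGet a_betaN (ivar b_l)) (RGet a_x (ivar b_l)))))).

Definition switched (e : iexp) : bexp :=
  ILe (isucc (IGet b_rank (ivar b_j))) e.

Definition sum_blocks : cmd :=
  For b_j (ivar a_m)
    (If (switched (ivar b_delta))
       (Seq (RSet b_t (IConst 0) (RAdd (rvar b_t) (RGet b_vstar (ivar b_j))))
            (RSet b_h (IConst 0) (RAdd (rvar b_h) (RConst 1))))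
       (RSet b_t (IConst 0) (RAdd (rvar b_t) (RGet b_v (ivar b_j))))).

Definition penalty : rexp :=
  RAdd (rvar a_s)
       (RMul (rvar a_lambda)
             (RPow (rvar b_h) (RDiv (RConst 1) (rvar a_p)))).

Definition objective : rexp :=
  RAdd (RExp (RSub (RConst 0) penalty))
       (RExp (RSub (RSub (RConst 0)
                         (RAdd (RMul (rvar a_y) (RAdd (rvar b_dotN) (rvar a_beta0)))
                               (rvar b_t)))
                   penalty)).

Definition evaluate : cmd :=
  Seq (RSet b_t (IConst 0) (RConst 0))
  (Seq (RSet b_h (IConst 0) (RConst 0))
  (Seq sum_blocks
       (RSet b_val (IConst 0) objective))).

Definition keep_best : cmd :=
  If (RLe (rvar b_val) (rvar b_bestval)) Skip
     (Seq (RSet b_bestval (IConst 0) (rvar b_val))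
          (ISet b_best (IConst 0) (ivar b_delta))).

Definition find_delta : cmd :=
  Seq (RSet b_bestval (IConst 0) (RConst 0))
      (For b_delta (isucc (ivar a_m)) (Seq evaluate keep_best)).

Definition write_out : cmd :=
  For b_j (ivar a_m)
    (If (switched (ivar b_best))
       (ISet a_out (ivar b_j) (IGet a_zstar (ivar b_j)))
       (ISet a_out (ivar b_j) (IGet a_z (ivar b_j)))).

Definition greedy : cmd :=
  Seq find_zstar
  (Seq sort_gains
  (Seq compute_dotN
  (Seq find_delta write_out))).

(** Decides comparisons between closed array numbers and leaves those between symbolic indices
    untouched. *)
Ltac mem_simpl :=
  rewrite /= /upd;
  repeat match goal with
  | |- context [ (?a == ?b :> nat) ] =>
    let v := eval vm_compute in (a == b :> nat) in
    match v with
    | true => change (a == b :> nat) with true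
    | false => change (a == b :> nat) with false
    end
  end; rewrite /= ?eqxx.

(** * Effect of each phase on the memory *)

Section GreedySteps.
Context (R : realType).
Implicit Types (s : store R).

(* The contribution to [y * beta_C^T z] of a block stored at [off] whose
   nonzero entry has location [c]. *)
Definition locval s (off c : nat) : R :=
  if c is l.+1 then rmem s a_y 0 * rmem s a_betaC (off + l)%N else 0.

Lemma locval_unchanged c s s' off l :
  unchanged c s s' -> a_y \notin rwrites c -> a_betaC \notin rwrites c ->
  locval s' off l = locval s off l.
Proof. by move=> [_ un] ny nb; case: l => //= l; rewrite !un. Qed.

Lemma run_init_block s :
  let j := imem s b_j 0 in
  let z := imem s a_z j in
  let val := locval s (imem s b_off 0) in
  let s' := run init_block s in
  forall i,
  [/\ imem s' a_zstar i = if i == j then (z == 0%N : nat) else imem s a_zstar i,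
      rmem s' b_vstar i = if i == j then val (z == 0%N) else rmem s b_vstar i &
      rmem s' b_v i = if i == j then val z else rmem s b_v i].
Proof.
move=> j z val s' i; rewrite /s' /init_block run_if.
have -> : beval s (ILe (IGet a_z (ivar b_j)) (IConst 0)) = (z == 0%N).
  by rewrite /= leqn0.
rewrite -/j; case: (boolP (z == 0%N)) => [/eqP z0|z_neq0];
  rewrite !run_seq !run_iset !run_rset; mem_simpl; rewrite -/j -/z.
  by split; case: eqP => // _; rewrite /val ?z0 /= ?addn0.
split; case: eqP => // _; rewrite /val; case: z z_neq0 => [|l] //= _.
by rewrite subn1.
Qed.

Lemma run_scan_block s :
  let j := imem s b_j 0 in
  let z := imem s a_z j in
  let val := locval s (imem s b_off 0) in
  let s' := run scan_block s in
  let zstar := imem s' a_zstar j in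
  (1 < imem s a_k j)%N ->
  imem s a_zstar j = (z == 0%N) -> rmem s b_vstar j = val (imem s a_zstar j) ->
  [/\ (zstar < imem s a_k j)%N, zstar != z, rmem s' b_vstar j = val zstar,
      (forall c, (c < imem s a_k j)%N -> c != z -> val zstar <= val c) &
      forall i : nat, i != j -> imem s' a_zstar i = imem s a_zstar i /\
                         rmem s' b_vstar i = rmem s b_vstar i].
Proof.
move=> j z val s' zstar k_gt1 zstar0 vstar0.
(* Iteration [q] tests location [q + 1], so [q] iterations cover locations up to [q]; location 0 is
   accounted for by the initialisation. *)
pose P q s1 :=
  [/\ (imem s1 a_zstar j < imem s a_k j)%N, imem s1 a_zstar j != z,
      rmem s1 b_vstar j = val (imem s1 a_zstar j),
      (forall c, (c <= q)%N -> c != z -> val (imem s1 a_zstar j) <= val c) &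
      forall i : nat, i != j -> imem s1 a_zstar i = imem s a_zstar i /\
                         rmem s1 b_vstar i = rmem s b_vstar i].
suff : P (imem s a_k j - 1)%N s'.
  case=> zk zz vz minz frame; split=> // c ck; apply: minz.
  by rewrite -ltnS subn1 prednK // ltnW.
apply: (@run_for _ P b_l (ISub (IGet a_k (ivar b_j)) (IConst 1))).
  split=> //; rewrite zstar0.
  - by apply: leq_ltn_trans k_gt1; case: (z == 0%N).
  - by case: (z).
  by move=> c; rewrite leqn0 => /eqP -> neq0; rewrite eq_sym (negPf neq0).
move=> q s1; rewrite -/j => ltq un [zk zz vz minz frame].
rewrite run_if.
set s2 := iset s1 b_l 0 q.
have e2 : reval s2 (entry (ivar b_l)) = val q.+1.
  by rewrite /s2; mem_simpl; rewrite (un.1 b_off) // (un.2 a_y) // (un.2 a_betaC).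
rewrite (_ : beval _ _ = (z != q.+1) && ~~ (rmem s1 b_vstar j <= val q.+1)); last first.
  rewrite -e2 /s2; mem_simpl.
  by rewrite (un.1 a_z) // (un.1 b_j) // addn1 -eqn_leq.
have leS c : (c <= q.+1)%N -> c != q.+1 -> (c <= q)%N.
  by rewrite leq_eqVlt => /orP[/eqP ->|]; rewrite ?eqxx.
case: ifP => [/andP[z_neq]|].
  rewrite -ltNge => lt_val; rewrite run_seq run_iset run_rset.
  have -> : ieval s2 (ivar b_j) = j by rewrite /s2; mem_simpl; rewrite un.1.
  have -> : ieval s2 (isucc (ivar b_l)) = q.+1 by rewrite /s2; mem_simpl; rewrite addn1.
  rewrite /P; mem_simpl.
  rewrite (un.1 b_j) // (un.1 b_off) // (un.2 a_y) // (un.2 a_betaC) // -/j eqxx.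
  split=> //.
  - by move: ltq; rewrite /= ltn_subRL add1n.
  - by rewrite eq_sym.
  - move=> c lec cz; have [->//|neqc] := eqVneq c q.+1.
    by apply: le_trans (ltW lt_val) _; rewrite vz minz // leS.
  by move=> i neq_i; rewrite !(negPf neq_i); exact: frame.
move=> /negbT; rewrite negb_and !negbK run_skip => skip.
rewrite /P; mem_simpl; split=> // c lec cz.
have [eqc|neqc] := eqVneq c q.+1; last by rewrite minz // leS.
by case/orP: skip => [/eqP eqz|]; [rewrite eqc -eqz eqxx in cz | rewrite vz eqc].
Qed.

Lemma run_find_zstar s :
  (forall j, (j < imem s a_m 0)%N -> (1 < imem s a_k j)%N) ->
  let s' := run find_zstar s in
  forall j, (j < imem s a_m 0)%N ->
  let z := imem s a_z j in
  let zstar := imem s' a_zstar j in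
  let val := locval s (\sum_(i < j) (imem s a_k i).-1)%N in
  [/\ (zstar < imem s a_k j)%N, zstar != z, rmem s' b_vstar j = val zstar,
      rmem s' b_v j = val z &
      forall c, (c < imem s a_k j)%N -> c != z -> val zstar <= val c].
Proof.
move=> k_gt1; rewrite /find_zstar run_seq run_iset.
set s0 := iset s b_off 0 0.
have i0 a i : a != b_off -> imem s0 a i = imem s a i by move=> neq; rewrite /= updN.
pose body := Seq init_block (Seq scan_block next_block).
pose val j := locval s (\sum_(i < j) (imem s a_k i).-1)%N.
(* The offset has to be part of the invariant, since it locates the coefficients of the next block;
   [val] refers to the initial store, whose coefficients are never overwritten. *)
pose P q s1 := imem s1 b_off 0 = (\sum_(i < q) (imem s a_k i).-1)%N /\
  forall j, (j < q)%N ->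
  [/\ (imem s1 a_zstar j < imem s a_k j)%N, imem s1 a_zstar j != imem s a_z j,
      rmem s1 b_vstar j = val j (imem s1 a_zstar j),
      rmem s1 b_v j = val j (imem s a_z j) &
      forall c, (c < imem s a_k j)%N -> c != imem s a_z j ->
        val j (imem s1 a_zstar j) <= val j c].
suff [] : P (imem s a_m 0) (run (For b_j (ivar a_m) body) s0) by [].
rewrite -(i0 a_m 0%N) //.
apply: (@run_for _ P b_j (ivar a_m)); first by split=> //; rewrite big_ord0.
move=> q s1 ltq un [off1 inv1]; set s2 := iset s1 b_j 0 q.
rewrite /body !run_seq.
have j2 : imem s2 b_j 0 = q by rewrite /s2; mem_simpl.
have z2 i : imem s2 a_z i = imem s a_z i.
  by rewrite /s2 /= updN // un.1 // i0.
have k2 i : imem s2 a_k i = imem s a_k i.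
  by rewrite /s2 /= updN // un.1 // i0.
have off2 : imem s2 b_off 0 = (\sum_(i < q) (imem s a_k i).-1)%N by rewrite -off1.
have val2 c : locval s2 (imem s2 b_off 0) c = val q c.
  by rewrite off2; exact: (locval_unchanged _ _ un).
have := run_init_block s2; have un3 := unchanged_run init_block s2.
cbv zeta; rewrite j2 z2 !val2; set s3 := run init_block s2 in un3 *; move=> init.
have j3 : imem s3 b_j 0 = q by rewrite un3.1.
have val3 c : locval s3 (imem s3 b_off 0) c = val q c.
  by rewrite un3.1 // -val2; exact: (locval_unchanged _ _ un3).
have := run_scan_block (s := s3); have un4 := unchanged_run scan_block s3.
cbv zeta; rewrite j3 (un3.1 a_z) // (un3.1 a_k) // z2 k2.
set s4 := run scan_block s3 in un4 *.
have [st3 vst3 v3] := init q; rewrite !eqxx in st3 vst3 v3.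
have ltq' : (q < imem s a_m 0)%N by rewrite -(i0 a_m 0%N).
case; rewrite ?val3 ?st3 //; first exact: k_gt1.
move=> zk zz vz minz frame; rewrite ?val3 in vz; clearbody s4.
split.
  rewrite /next_block run_iset; mem_simpl.
  by rewrite !un4.1 // un3.1 // off2 un3.1 // j3 k2 subn1 big_ord_recr.
move=> j; rewrite ltnS leq_eqVlt /next_block run_iset; mem_simpl.
rewrite (un4.2 b_v) //.
case/orP => [/eqP ->|ltjq].
  by split=> // c ck cz; move: (minz c ck cz); rewrite ?val3.
have neqj : j != q by rewrite neq_ltn ltjq.
have [-> ->] := frame j neqj; have [-> -> ->] := init j; rewrite (negPf neqj).
rewrite /s2; mem_simpl; exact: inv1.
Qed.

(* Ties are broken by index, which makes the rank injective. *)
Definition precedes (g : nat -> R) (l j : nat) : bool :=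
  (g l <= g j) && ~~ ((g j <= g l) && (j <= l)%N).

Definition rank (g : nat -> R) (m j : nat) : nat := (\sum_(l < m) precedes g l j)%N.

Lemma precedes_irr g j : precedes g j j = false.
Proof. by rewrite /precedes !lexx leqnn. Qed.

Lemma precedes_trans g i j l : precedes g l i -> precedes g i j -> precedes g l j.
Proof.
rewrite /precedes !negb_and -!ltNge -!ltnNge => /andP[li lti] /andP[ij ltj].
rewrite (le_trans li ij) /=.
case/orP: lti => [lt|lt]; first by rewrite (lt_le_trans lt ij).
case/orP: ltj => [lt'|lt']; first by rewrite (le_lt_trans li lt').
by rewrite (ltn_trans lt lt') orbT.
Qed.

Lemma precedes_total g i j : i != j -> precedes g i j || precedes g j i.
Proof.
rewrite /precedes !negb_and -!ltNge -!ltnNge neq_ltn.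
by case: (ltgtP (g i) (g j)) => //= _.
Qed.

Lemma rankE g m j : rank g m j = #|[set l : 'I_m | precedes g l j]%SET|.
Proof.
rewrite /rank -sum1_card [RHS]big_mkcond; apply: eq_bigr => l _.
by rewrite inE; case: precedes.
Qed.

Lemma rank_lt g m j : (j < m)%N -> (rank g m j < m)%N.
Proof.
move=> ltj; rewrite rankE -[X in (_ < X)%N]card_ord -cardsT; apply: proper_card.
apply/properP; split; first exact: finset.subsetT.
by exists (Ordinal ltj); rewrite inE //= precedes_irr.
Qed.

(** By transitivity the predecessors of [i] are predecessors of [j]; the inclusion is proper because
    [i] precedes [j] but not itself. *)
Lemma rank_mono g m i j :
  (i < m)%N -> precedes g i j -> (rank g m i < rank g m j)%N.
Proof.
move=> lti ij; rewrite !rankE; apply: proper_card; apply/properP; split.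
  by apply/fintype.subsetP => l; rewrite !inE => /precedes_trans; apply.
by exists (Ordinal lti); rewrite inE //= precedes_irr.
Qed.

Lemma rank_inj g m i j :
  (i < m)%N -> (j < m)%N -> rank g m i = rank g m j -> i = j.
Proof.
move=> lti ltj eqr; have [//|neq] := eqVneq i j.
by case/orP: (precedes_total g neq) => /rank_mono lt_rank;
  [have := lt_rank m lti | have := lt_rank m ltj]; rewrite eqr ltnn.
Qed.

(** A strictly smaller gain would force a strictly smaller rank. This yields the ordering required
    by step 2. *)
Lemma rank_le g m i j :
  (j < m)%N -> (rank g m i <= rank g m j)%N -> g i <= g j.
Proof.
move=> ltj ler; rewrite leNgt; apply: contraTN ler => lt; rewrite -ltnNge.
by apply: rank_mono => //; rewrite /precedes (ltW lt) leNgt lt.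
Qed.
Definition gain s (l : nat) : R := rmem s b_vstar l - rmem s b_v l.

Lemma run_count_before s i :
  imem (run count_before s) b_rank i =
  if i == imem s b_j 0
  then (imem s b_rank i + rank (gain s) (imem s a_m 0) i)%N
  else imem s b_rank i.
Proof.
set j := imem s b_j 0.
pose P q s1 := imem s1 b_rank i =
  if i == j then (imem s b_rank i + rank (gain s) q i)%N else imem s b_rank i.
apply: (@run_for _ P b_l (ivar a_m)).
  by rewrite /P /rank big_ord0 addn0 if_same.
move=> q s1 ltq un Pq; rewrite run_if; set s2 := iset s1 b_l 0 q.
have -> : beval s2 (BAnd (RLe (gain_at (ivar b_l)) (gain_at (ivar b_j)))
              (BNot (BAnd (RLe (gain_at (ivar b_j)) (gain_at (ivar b_l)))
                          (ILe (ivar b_j) (ivar b_l))))) = precedes (gain s) q j.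
  by rewrite /s2; mem_simpl; rewrite !un.2 // !un.1.
rewrite /P /rank big_ord_recr /= addnA -/(rank _ _ _).
have jE : ieval s2 (ivar b_j) = j by rewrite /s2; mem_simpl; rewrite un.1.
case: ifP => prec; last first.
  rewrite run_skip /s2; mem_simpl; rewrite Pq; case: eqP => // ->.
  by rewrite prec addn0.
rewrite run_iset jE /s2; mem_simpl; rewrite (un.1 b_j) // -/j.
by move: Pq; rewrite /P; case: eqP => [->|//] ->; rewrite prec.
Qed.

Lemma run_sort_gains s :
  let s' := run sort_gains s in
  let m := imem s a_m 0 in
  forall j, (j < m)%N ->
  imem s' b_rank j = rank (gain s) m j /\ imem s' a_pi (rank (gain s) m j) = j.
Proof.
move=> s' m; pose P q s1 := forall j, (j < q)%N ->
  imem s1 b_rank j = rank (gain s) m j /\ imem s1 a_pi (rank (gain s) m j) = j.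
suff : P m s' by [].
apply: (@run_for _ P b_j (ivar a_m)) => // q s1 ltq un Pq j.
rewrite ltnS leq_eqVlt !run_seq !run_iset.
set s2 := iset (iset s1 b_j 0 q) b_rank _ _; set s3 := run count_before s2.
have un3 : unchanged count_before s2 s3 := unchanged_run _ _.
have j2 : imem s2 b_j 0 = q by rewrite /s2; mem_simpl.
have j3 : imem s3 b_j 0 = q by rewrite un3.1.
have m2 : imem s2 a_m 0 = m by rewrite /s2; mem_simpl; rewrite un.1.
have pi3 i : imem s3 a_pi i = imem s1 a_pi i by rewrite un3.1 // /s2; mem_simpl.
have gain2 : gain s2 = gain s by apply/funext => l; rewrite /gain /s2 /= !un.2.
have rank3 i : imem s3 b_rank i =
    if i == q then rank (gain s) m q else imem s1 b_rank i.
  rewrite /s3 run_count_before j2 m2 gain2 /s2; mem_simpl.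
  by case: eqP => // ->.
clearbody s3; mem_simpl; rewrite j3 !rank3 pi3 eqxx.
case/orP => [/eqP -> | ltjq]; first by rewrite !eqxx.
have [-> ->] := Pq _ ltjq; have neqj : j != q by rewrite neq_ltn ltjq.
(* The new write to [a_pi] cannot hit an earlier entry, because distinct blocks have distinct
   ranks. *)
rewrite (negPf neqj); split=> //; case: eqP => // /rank_inj eqj.
by rewrite eqj // (ltn_trans ltjq).
Qed.

Lemma run_compute_dotN s :
  rmem (run compute_dotN s) b_dotN 0
  = \sum_(l < imem s a_n 0) rmem s a_betaN l * rmem s a_x l.
Proof.
rewrite /compute_dotN run_seq run_rset; set s0 := rset s _ _ _.
pose P q s1 := rmem s1 b_dotN 0 = \sum_(l < q) rmem s a_betaN l * rmem s a_x l.
apply: (@run_for _ P b_l (ivar a_n)); first by rewrite /P big_ord0 /s0; mem_simpl.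
move=> q s1 ltq un Pq; rewrite run_rset /P big_ord_recr /= -Pq; mem_simpl.
by rewrite (un.2 a_betaN) // (un.2 a_x) // /s0; mem_simpl.
Qed.

Lemma run_sum_blocks s :
  let m := imem s a_m 0 in
  let on (j : nat) := (imem s b_rank j < imem s b_delta 0)%N in
  let s' := run sum_blocks s in
  rmem s' b_t 0 = rmem s b_t 0 +
    \sum_(j < m) (if on j then rmem s b_vstar j else rmem s b_v j) /\
  rmem s' b_h 0 = rmem s b_h 0 + \sum_(j < m) (on j)%:R.
Proof.
move=> m on s'.
pose P q s1 := rmem s1 b_t 0 = rmem s b_t 0 +
    \sum_(j < q) (if on j then rmem s b_vstar j else rmem s b_v j) /\
  rmem s1 b_h 0 = rmem s b_h 0 + \sum_(j < q) (on j)%:R.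
suff : P m s' by [].
apply: (@run_for _ P b_j (ivar a_m)); first by rewrite /P !big_ord0 !addr0.
move=> q s1 ltq un [tq hq]; rewrite run_if /P !big_ord_recr /=.
set s2 := iset s1 b_j 0 q.
have -> : (upd (imem s1) b_j 0 q b_rank (upd (imem s1) b_j 0 q b_j 0) + 1 <=
           upd (imem s1) b_j 0 q b_delta 0)%N = on q.
  by mem_simpl; rewrite !un.1 // addn1.
case: ifP => onq; rewrite ?run_seq !run_rset /s2; mem_simpl.
  by rewrite tq hq !addrA (un.2 b_vstar).
by rewrite tq hq !addrA (un.2 b_v) ?addr0.
Qed.

(** The result of [evaluate] as a function of cells that the search over [delta] never writes, so
    all candidates can be compared in one reference store; [inner_min_switch] identifies it with
    [inner_min]. *)
Definition switch_value s (delta : nat) : R :=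
  let m := imem s a_m 0 in
  let on (j : nat) := (imem s b_rank j < delta)%N in
  let penalty := rmem s a_s 0 +
    rmem s a_lambda 0 * (\sum_(j < m) (on j)%:R) `^ (1 / rmem s a_p 0) in
  expR (- penalty) +
  expR (- (rmem s a_y 0 * (rmem s b_dotN 0 + rmem s a_beta0 0) +
           \sum_(j < m) (if on j then rmem s b_vstar j else rmem s b_v j))
        - penalty).

Lemma run_evaluate s :
  rmem (run evaluate s) b_val 0 = switch_value s (imem s b_delta 0).
Proof.
rewrite /evaluate !run_seq !run_rset; set s1 := rset (rset _ _ _ _) _ _ _.
have [] := run_sum_blocks s1; set s2 := run sum_blocks s1 => t2 h2.
have un : unchanged sum_blocks s1 s2 := unchanged_run _ _.
clearbody s2; rewrite /objective /penalty; mem_simpl.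
rewrite t2 h2 (un.2 a_s 0%N isT) (un.2 a_lambda 0%N isT) (un.2 a_p 0%N isT).
rewrite (un.2 a_y 0%N isT) (un.2 b_dotN 0%N isT) (un.2 a_beta0 0%N isT).
rewrite /s1; mem_simpl.
by rewrite !add0r.
Qed.

(* Values are positive, so the initial value 0 of [b_bestval] is replaced at
   the first iteration. *)
Lemma switch_value_gt0 s delta : 0 < switch_value s delta.
Proof. by rewrite addr_gt0 ?expR_gt0. Qed.

Lemma switch_value_unchanged c s s' delta :
  unchanged c s s' ->
  (a_m \notin iwrites c) && (b_rank \notin iwrites c) ->
  all (fun a => a \notin rwrites c)
    [:: a_s; a_lambda; a_p; a_y; b_dotN; a_beta0; b_vstar; b_v] ->
  switch_value s' delta = switch_value s delta.
Proof.
move=> [iu ru] /andP[nm nr] /allP nrw.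
rewrite /switch_value (iu a_m 0%N nm).
rewrite !(ru a_s, ru a_lambda, ru a_p, ru a_y, ru b_dotN, ru a_beta0); do ?exact: nrw.
have -> : imem s' b_rank = imem s b_rank by apply/funext => j; exact: iu.
have -> : rmem s' b_vstar = rmem s b_vstar.
  by apply/funext => j; apply: ru; exact: nrw.
by have -> : rmem s' b_v = rmem s b_v by apply/funext => j; apply: ru; exact: nrw.
Qed.

Lemma run_find_delta s :
  let best := imem (run find_delta s) b_best 0 in
  (best <= imem s a_m 0)%N /\
  forall delta, (delta <= imem s a_m 0)%N ->
    switch_value s delta <= switch_value s best.
Proof.
rewrite /find_delta run_seq run_rset; set s0 := rset s _ _ _.
have value0 delta : switch_value s0 delta = switch_value s delta.
  exact: (switch_value_unchanged _
            (unchanged_run (RSet b_bestval (IConst 0) (RConst 0)) s)).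
(* Before the first iteration [b_best] holds arbitrary memory, hence the guard [0 < q] and the
   separate case [q == 0]. *)
pose P q s1 :=
  [/\ (0 < q)%N -> (imem s1 b_best 0 < q)%N,
      rmem s1 b_bestval 0
        = if q == 0%N then 0 else switch_value s (imem s1 b_best 0) &
      forall delta, (delta < q)%N -> switch_value s delta <= rmem s1 b_bestval 0].
set s' := run _ s0.
suff : P (imem s a_m 0).+1 s' by case=> /(_ isT) lem /= -> max.
have -> : (imem s a_m 0).+1 = ieval s0 (isucc (ivar a_m)) by rewrite /= addn1.
apply: (@run_for _ P b_delta (isucc (ivar a_m))).
  by split=> //; rewrite /s0; mem_simpl.
move=> q s1 ltq un [ltbest bestv max]; rewrite run_seq.
have := run_evaluate (iset s1 b_delta 0 q).
have := unchanged_run evaluate (iset s1 b_delta 0 q).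
set s2 := iset s1 b_delta 0 q; set s3 := run evaluate s2 => un3.
have -> : imem s2 b_delta 0 = q by rewrite /s2; mem_simpl.
have -> : switch_value s2 q = switch_value s q.
  by rewrite -value0 -(switch_value_unchanged q un).
move=> val3.
have best3 : imem s3 b_best 0 = imem s1 b_best 0 by rewrite un3.1 // /s2; mem_simpl.
have bestv3 : rmem s3 b_bestval 0 = rmem s1 b_bestval 0 by rewrite un3.2.
have delta3 : imem s3 b_delta 0 = q by rewrite un3.1 // /s2; mem_simpl.
clearbody s3; rewrite /keep_best run_if [beval _ _]/= val3 bestv3.
have leS delta : (delta < q.+1)%N -> delta = q \/ (delta < q)%N.
  by rewrite ltnS leq_eqVlt => /orP[/eqP|]; [left | right].
case: ifP => [le_val|/negbT]; last first.
  rewrite -ltNge => lt_val; rewrite run_seq run_rset run_iset /P; mem_simpl.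
  rewrite delta3 val3; split; [by move=> _ | by [] |].
  move=> delta /leS[->|/max le_delta]; first exact: lexx.
  exact: le_trans le_delta (ltW lt_val).
rewrite run_skip /P best3 bestv3.
have q_gt0 : (0 < q)%N.
  rewrite lt0n; apply/eqP => q0; move: le_val.
  by rewrite bestv q0 eqxx leNgt switch_value_gt0.
split.
- by move=> _; exact: leqW (ltbest q_gt0).
- rewrite bestv (gtn_eqF q_gt0) (gtn_eqF (ltn0Sn q)); exact: erefl.
- by move=> delta /leS[->|ltq']; [exact: le_val | exact: max].
Qed.

Lemma run_write_out s :
  let s' := run write_out s in
  forall j, (j < imem s a_m 0)%N ->
  imem s' a_out j =
    if (imem s b_rank j < imem s b_best 0)%N then imem s a_zstar j else imem s a_z j.
Proof.
move=> s'; pose P q s1 := forall j, (j < q)%N -> imem s1 a_out j =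
    if (imem s b_rank j < imem s b_best 0)%N then imem s a_zstar j else imem s a_z j.
suff : P (imem s a_m 0) s' by [].
apply: (@run_for _ P b_j (ivar a_m)) => // q s1 ltq un Pq j.
rewrite run_if ltnS leq_eqVlt; set s2 := iset s1 b_j 0 q.
have -> : beval s2 (switched (ivar b_best)) = (imem s b_rank q < imem s b_best 0)%N.
  by rewrite /s2; mem_simpl; rewrite !un.1 // addn1.
case: ifP => onq; rewrite run_iset /s2; mem_simpl.
  rewrite (un.1 a_zstar) //; case: eqP => [->|_ /Pq //]; by rewrite onq.
rewrite (un.1 a_z) //; case: eqP => [->|_ /Pq //]; by rewrite onq.
Qed.

End GreedySteps.

(** * One-hot blocks and their locations *)

(** Inverse of [loc] on numbers below [s]; 0 gives the zero vector since no [l.+1] is 0. *)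
Definition unblock (s c : nat) : catblock s := [ffun l : 'I_s.-1 => l.+1 == c].

Lemma onehotP (s : nat) (z : catblock s) (l l' : 'I_s.-1) :
  onehot z -> z l -> z l' -> l' = l.
Proof.
move=> one zl zl'; apply/eqP; apply: contraLR one => neq.
rewrite -ltnNge (bigD1 l) //= (bigD1 l') //= zl zl'.
by rewrite addnA ltn_addr.
Qed.

Lemma onehot_unblock (s c : nat) : onehot (unblock s c).
Proof.
rewrite /onehot /=; have [l /eqP lc|none] := pickP (fun l : 'I_s.-1 => l.+1 == c).
  rewrite (bigD1 l) //= big1 ?addn0; first by case: (unblock s c l).
  move=> l' neq; rewrite ffunE -lc eqSS; apply/eqP; rewrite eqb0.
  by apply: contra neq => /eqP /val_inj ->.
by rewrite big1 // => l _; rewrite ffunE none.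
Qed.

Lemma loc_unblock (s c : nat) : (c < s)%N -> loc (unblock s c) = c.
Proof.
move=> ltcs; rewrite /loc; case: pickP => [l|none]; first by rewrite ffunE => /eqP.
case: c ltcs none => [//|c] ltcs none.
have ltc : (c < s.-1)%N by rewrite -ltnS prednK // (leq_trans _ ltcs).
by have := none (Ordinal ltc); rewrite ffunE eqxx.
Qed.

Lemma loc_inj (s : nat) (z z' : catblock s) :
  onehot z -> onehot z' -> loc z = loc z' -> z = z'.
Proof.
move=> one one'; rewrite /loc.
case: pickP => [l zl|none]; case: pickP => [l' zl'|none'] //.
  move=> [eql]; apply/ffunP => x; apply/idP/idP.
    by move/(onehotP one zl) => ->; rewrite (val_inj eql).
  by move/(onehotP one' zl') => ->; rewrite -(val_inj eql).
by move=> _; apply/ffunP => x; rewrite none none'.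
Qed.

Lemma loc_lt (s : nat) (z : catblock s) : (0 < s)%N -> (loc z < s)%N.
Proof.
move=> s_gt0; rewrite /loc; case: pickP => // l _.
by rewrite -[leqRHS](prednK s_gt0) ltnS ltn_ord.
Qed.

(** * Decoding the final memory as a run of the algorithm *)

Section Memory.
Context (R : realType) (n m : nat) (k : 'I_m -> nat).
Context (I : subproblem R n k) (s : store R) (input : holds_input I s).
Context (k_ge2 : forall j, (2 <= k j)%N) (CC_z : CC (sp_z I)).

Let s1 := run find_zstar s.
Let s2 := run sort_gains s1.
Let s3 := run compute_dotN s2.
Let s4 := run find_delta s3.
Let s5 := run write_out s4.

Lemma imem_k (j : 'I_m) : imem s a_k j = k j.
Proof. by have [[_ _ + _] _ _] := input; apply. Qed.

Lemma imem_m : imem s a_m 0 = m.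
Proof. by have [[_ + _ _] _ _] := input. Qed.

Lemma imem_z (j : 'I_m) : imem s a_z j = loc (sp_z I j).
Proof. by have [[_ _ _ +] _ _] := input; apply. Qed.

(** A one-hot block selects at most one coefficient, so its contribution is a single memory
    access. *)
Lemma dotC_locval (j : 'I_m) (zj : catblock (k j)) :
  onehot zj ->
  sp_y I * dotC I zj = locval s (\sum_(i < j) (imem s a_k i).-1)%N (loc zj).
Proof.
move=> one; have [_ [_ _ betaC] [y _ _ _ _]] := input.
have -> : (\sum_(i < j) (imem s a_k i).-1
           = \sum_(j' < m | (j' < j)%N) (k j').-1)%N.
  rewrite (big_ord_widen m (fun i => (imem s a_k i).-1) (ltnW (ltn_ord j))).
  by apply: eq_bigr => i _; rewrite imem_k.
rewrite /loc /dotC; case: pickP => [l zl|none]; last first.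
  by rewrite big1 ?mulr0 // => l _; rewrite none mulr0.
rewrite /= y betaC (bigD1 l) //= zl mulr1 big1 ?addr0 // => l' neq.
case: (boolP (zj l')) => [/(onehotP one zl) eql|_]; last by rewrite mulr0.
by rewrite eql eqxx in neq.
Qed.

Definition zstar_out : catvec k := fun j => unblock (k j) (imem s1 a_zstar j).

(** The machine minimises over locations below [k j]; [loc] maps one-hot blocks injectively into
    these, so the minimum ranges over all admissible blocks. *)
Lemma zstar_outP (j : 'I_m) :
  [/\ loc (zstar_out j) = imem s1 a_zstar j, zstar_out j <> sp_z I j,
      rmem s1 b_vstar j = sp_y I * dotC I (zstar_out j),
      rmem s1 b_v j = sp_y I * dotC I (sp_z I j) &
      forall zj : catblock (k j), onehot zj -> zj <> sp_z I j ->
        sp_y I * dotC I (zstar_out j) <= sp_y I * dotC I zj].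
Proof.
have k_gt1 i : (i < imem s a_m 0)%N -> (1 < imem s a_k i)%N.
  by rewrite imem_m => lti; rewrite (imem_k (Ordinal lti)) k_ge2.
have ltj : (j < imem s a_m 0)%N by rewrite imem_m.
have := run_find_zstar k_gt1 ltj; rewrite -/s1 /= imem_k imem_z.
have k_gt0 : (0 < k j)%N by apply: leq_trans (k_ge2 j).
move=> [ltk neqz vs v min]; have locE := loc_unblock ltk.
split=> //.
- by move=> eqz; rewrite -locE -/(zstar_out j) eqz eqxx in neqz.
- by rewrite vs dotC_locval ?locE //; exact: onehot_unblock.
- by rewrite v dotC_locval //; exact: CC_z.
move=> zj one neq; rewrite !dotC_locval ?locE //; last exact: onehot_unblock.
apply: min; first exact: loc_lt.
by apply/eqP => /loc_inj eqz; apply: neq; apply: eqz => //; exact: CC_z.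
Qed.

Lemma step1_out : step1 I zstar_out.
Proof.
move=> j cands; have [_ neq _ _ min] := zstar_outP j.
by split=> [|zj [one neqz]]; [split=> //; exact: onehot_unblock | exact: min].
Qed.

Definition position (j : 'I_m) : 'I_m := Ordinal (rank_lt (gain s1) (ltn_ord j)).

Lemma position_inj : injective position.
Proof. by move=> i j [] /rank_inj eqij; apply: val_inj; apply: eqij. Qed.

(** Ranks send a block to its position, whereas the ordering sends a position to its block, hence
    the inverse. *)
Definition pi_out : {perm 'I_m} := (perm position_inj)^-1%g.

Lemma pi_outV (j : 'I_m) : (pi_out^-1)%g j = rank (gain s1) m j :> nat.
Proof. by rewrite /pi_out invgK permE. Qed.

Lemma rank_pi_out (i : 'I_m) : rank (gain s1) m (pi_out i) = i.
Proof. by rewrite -pi_outV permK. Qed.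

Lemma gain_out (j : 'I_m) :
  gain s1 j = sp_y I * (dotC I (zstar_out j) - dotC I (sp_z I j)).
Proof. by rewrite /gain mulrBr; have [_ _ -> -> _] := zstar_outP j. Qed.

Lemma step2_out : step2 I zstar_out pi_out.
Proof.
move=> i i' lei; rewrite -!gain_out; apply: (@rank_le _ _ m) => //.
by rewrite !rank_pi_out.
Qed.
Let un1 : unchanged find_zstar s s1 := unchanged_run find_zstar s.
Let un2 : unchanged sort_gains s1 s2 := unchanged_run sort_gains s1.
Let un3 : unchanged compute_dotN s2 s3 := unchanged_run compute_dotN s2.
Let un4 : unchanged find_delta s3 s4 := unchanged_run find_delta s3.
Let un5 : unchanged write_out s4 s5 := unchanged_run write_out s4.

Lemma sort_gains_out (j : 'I_m) :
  imem s2 b_rank j = rank (gain s1) m j /\ imem s2 a_pi j = pi_out j.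
Proof.
have m1 : imem s1 a_m 0 = m by rewrite un1.1 // imem_m.
have sorted (i : 'I_m) : imem s2 b_rank i = rank (gain s1) m i /\
                         imem s2 a_pi (rank (gain s1) m i) = i.
  by have := @run_sort_gains _ s1 i; rewrite m1; apply.
split; first by have [] := sorted j.
by have [_] := sorted (pi_out j); rewrite rank_pi_out.
Qed.

Lemma inner_min_switch (z : catvec k) (delta : nat) :
  (forall j, z j = if ((pi_out^-1)%g j < delta)%N then zstar_out j else sp_z I j) ->
  inner_min I z = switch_value s3 delta.
Proof.
move=> zE; have [[nE _ _ _] [x betaN _] [y beta0 lambda s0 p]] := input.
have rank3 (j : 'I_m) : imem s3 b_rank j = (pi_out^-1)%g j.
  by rewrite un3.1 // pi_outV; have [] := sort_gains_out j.
have frame a : a \notin rwrites find_zstar -> a \notin rwrites sort_gains ->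
    a \notin rwrites compute_dotN -> rmem s3 a 0 = rmem s a 0.
  by move=> w1 w2 w3; rewrite un3.2 // un2.2 // un1.2.
have m3 : imem s3 a_m 0 = m by rewrite un3.1 // un2.1 // un1.1 // imem_m.
have dotN3 : rmem s3 b_dotN 0 = dotN I.
  rewrite /s3 run_compute_dotN un2.1 // un1.1 // nE; apply: eq_bigr => l _.
  by rewrite !un2.2 // !un1.2 // betaN x.
(* The machine counts switched blocks, [dC] counts changed ones; they agree because [zstar_out j]
   always differs from [sp_z I j]. *)
have dist3 : \sum_(j < imem s3 a_m 0) (imem s3 b_rank j < delta)%:R
             = \sum_(j < m) (z j != sp_z I j)%:R :> R.
  rewrite m3; apply: eq_bigr => j _; rewrite rank3 zE; case: ifP => _.
    by case: eqP => // eqz; have [_ []] := zstar_outP j.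
  by rewrite eqxx.
have sum3 : \sum_(j < imem s3 a_m 0)
    (if (imem s3 b_rank j < delta)%N then rmem s3 b_vstar j else rmem s3 b_v j)
    = sp_y I * \sum_(j < m) dotC I (z j).
  rewrite m3 mulr_sumr; apply: eq_bigr => j _; rewrite rank3 zE.
  have [_ _ vs v _] := zstar_outP j; case: ifP => _.
    by rewrite -vs un3.2 // un2.2.
  by rewrite -v un3.2 // un2.2.
rewrite /switch_value dist3 sum3 dotN3 !frame // y beta0 lambda s0 p.
rewrite /inner_min /dC.
set d := _ `^ _; set t := \sum_(j < m) _.
by congr (expR _ + expR _); ring.
Qed.

Let best := imem s4 b_best 0.

Definition z_out : catvec k := fun j =>
  if ((pi_out^-1)%g j < best)%N then zstar_out j else sp_z I j.

Lemma greedy_run_out : greedy_run I zstar_out pi_out z_out.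
Proof.
have m3 : imem s3 a_m 0 = m by rewrite un3.1 // un2.1 // un1.1 // imem_m.
have [best_le best_max] := run_find_delta s3; rewrite m3 in best_le best_max.
split; [exact: step1_out | exact: step2_out |].
apply/most_violated_inE; split; first by exists best.
move=> z [delta delta_le zE].
rewrite (inner_min_switch zE) (@inner_min_switch z_out best (fun=> erefl)).
exact: best_max delta_le.
Qed.

Lemma holds_run_out : holds_run s5 zstar_out pi_out z_out.
Proof.
move=> j; have [locE _ _ _ _] := zstar_outP j; have [rankE piE] := sort_gains_out j.
have m4 : imem s4 a_m 0 = m by rewrite un4.1 // un3.1 // un2.1 // un1.1 // imem_m.
have ltj : (j < imem s4 a_m 0)%N by rewrite m4.
have zstar4 : imem s4 a_zstar j = loc (zstar_out j).
  by rewrite un4.1 // un3.1 // un2.1 // locE.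
have z4 : imem s4 a_z j = loc (sp_z I j).
  by rewrite un4.1 // un3.1 // un2.1 // un1.1 // imem_z.
split.
- by rewrite un5.1.
- by rewrite un5.1 // un4.1 // un3.1.
rewrite /s5 run_write_out // zstar4 z4 un4.1 // un3.1 // rankE -pi_outV.
by rewrite /z_out; case: ifP.
Qed.

End Memory.

(** * Running time *)

Fixpoint loopfree (c : cmd) : bool :=
  match c with
  | Skip | ISet _ _ _ | RSet _ _ _ => true
  | Seq c1 c2 | If _ c1 c2 => loopfree c1 && loopfree c2
  | For _ _ _ => false
  end.

(** Independent of the store, hence evaluated by computation on concrete code. The value 0 for loops
    is a dummy that [loopfree] excludes. *)
Fixpoint cost_bound (c : cmd) : nat :=
  match c with
  | Skip => 1
  | ISet _ e1 e2 => (icost e1 + icost e2).+1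
  | RSet _ e1 e2 => (icost e1 + rcost e2).+1
  | Seq c1 c2 => cost_bound c1 + cost_bound c2
  | If b c1 c2 => (bcost b + maxn (cost_bound c1) (cost_bound c2)).+1
  | For _ _ _ => 0
  end.

Section Costs.
Context (R : realType).
Implicit Types (s : store R) (c : cmd).

Lemma cost_seq c1 c2 s : cost (Seq c1 c2) s = (cost c1 s + cost c2 (run c1 s))%N.
Proof. by []. Qed.

Lemma cost_loopfree c s : loopfree c -> (cost c s <= cost_bound c)%N.
Proof.
elim: c s => [|a e1 e2|a e1 e2|c1 IH1 c2 IH2|b c1 IH1 c2 IH2|] //= s /andP[l1 l2].
  by rewrite cost_seq leq_add ?IH1 ?IH2.
rewrite /cost /= ltnS leq_add2l leq_max.
by case: (beval s b); rewrite (IH1, IH2) // orbT.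
Qed.

Lemma cost_loopfree_le T c s :
  loopfree c -> (cost_bound c <= T)%N -> (cost c s <= T)%N.
Proof. by move=> lf; apply: leq_trans; exact: cost_loopfree. Qed.

Lemma cost_for_le (T : nat) a e c s :
  (forall i s', (i < ieval s e)%N -> unchanged (For a e c) s s' ->
     (cost c (iset s' a 0 i) <= T)%N) ->
  (cost (For a e c) s <= (icost e).+1 + ieval s e * T.+1)%N.
Proof. by move=> /cost_for; rewrite sum_nat_const card_ord. Qed.

Lemma cost_for_loopfree a e c s :
  loopfree c -> (cost (For a e c) s <= (icost e).+1 + ieval s e * (cost_bound c).+1)%N.
Proof. by move=> lf; apply: cost_for_le => i s' _ _; exact: cost_loopfree. Qed.

Lemma cost_scan_block s :
  (cost scan_block s <= 10 + 90 * (imem s a_k (imem s b_j 0)).-1)%N.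
Proof.
apply: leq_trans (cost_for_loopfree _ _ _ _) _ => //.
by rewrite leq_add // [ieval _ _]/= subn1 mulnC leq_mul2r orbT.
Qed.

Lemma cost_find_zstar s :
  (cost find_zstar s
   <= 100 + \sum_(j < imem s a_m 0) (100 + 90 * (imem s a_k j).-1))%N.
Proof.
rewrite cost_seq -[100%N]/(50 + 50)%N -addnA.
apply: leq_add; first exact: cost_loopfree_le.
set s0 := run _ s.
have un0 : unchanged (ISet b_off (IConst 0) (IConst 0)) s s0 := unchanged_run _ _.
(* The bound has 99 instead of 100 because [cost_for] adds one unit per iteration. *)
have body_le i s1 : (i < ieval s0 (ivar a_m))%N ->
    unchanged (For b_j (ivar a_m) (Seq init_block (Seq scan_block next_block))) s0 s1 ->
    (cost (Seq init_block (Seq scan_block next_block)) (iset s1 b_j 0 i)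
     <= 99 + 90 * (imem s a_k i).-1)%N.
  move=> _ un; set s2 := iset s1 b_j 0 i; rewrite !cost_seq.
  set s3 := run init_block s2.
  have un3 : unchanged init_block s2 s3 := unchanged_run _ _.
  have init_le : (cost init_block s2 <= 30)%N by exact: cost_loopfree_le.
  have next_le s' : (cost next_block s' <= 30)%N by exact: cost_loopfree_le.
  have := cost_scan_block s3; rewrite !un3.1 // /s2; mem_simpl.
  rewrite un.1 // un0.1 // => scan_le.
  have := next_le (run scan_block s3); move: init_le scan_le; rewrite -/s2.
  by move: (cost _ _) (cost _ _) (cost _ _) => x y z; lia.
have m0 : ieval s0 (ivar a_m) = imem s a_m 0 by exact: un0.1.
apply: leq_trans (cost_for body_le) _; rewrite m0.
by rewrite leq_add //; apply: leq_sum => j _.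
Qed.

Lemma cost_count_before s : (cost count_before s <= 10 + 90 * imem s a_m 0)%N.
Proof.
apply: leq_trans (cost_for_loopfree _ _ _ _) _ => //.
by rewrite leq_add // [ieval _ _]/= mulnC leq_mul2r orbT.
Qed.

Lemma cost_sort_gains s :
  (cost sort_gains s <= 100 + imem s a_m 0 * (100 + 90 * imem s a_m 0))%N.
Proof.
pose body := Seq (ISet b_rank (ivar b_j) (IConst 0))
               (Seq count_before (ISet a_pi (IGet b_rank (ivar b_j)) (ivar b_j))).
have body_le i s1 : (i < ieval s (ivar a_m))%N ->
    unchanged (For b_j (ivar a_m) body) s s1 ->
    (cost body (iset s1 b_j 0 i) <= 99 + 90 * imem s a_m 0)%N.
  move=> _ un; rewrite !cost_seq; set c1 := ISet b_rank _ _; set c2 := ISet a_pi _ _.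
  have le1 s' : (cost c1 s' <= 40)%N by exact: cost_loopfree_le.
  have le2 s' : (cost c2 s' <= 40)%N by exact: cost_loopfree_le.
  have := cost_count_before (run c1 (iset s1 b_j 0 i)).
  rewrite (unchanged_run c1 _).1 //; mem_simpl; rewrite un.1 // => le3.
  move: le3 (le1 (iset s1 b_j 0 i)).
  move: (le2 (run count_before (run c1 (iset s1 b_j 0 i)))).
  by move: (cost _ _) (cost _ _) (cost _ _) => x y z; lia.
by apply: leq_trans (cost_for_le body_le) _; rewrite leq_add.
Qed.

Lemma cost_compute_dotN s : (cost compute_dotN s <= 100 + 90 * imem s a_n 0)%N.
Proof.
rewrite cost_seq -[100%N]/(50 + 50)%N -addnA.
apply: leq_add; first exact: cost_loopfree_le.
apply: leq_trans (cost_for_loopfree _ _ _ _) _ => //.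
by rewrite leq_add // [ieval _ _]/= mulnC leq_mul2r orbT.
Qed.

Lemma cost_sum_blocks s : (cost sum_blocks s <= 10 + 90 * imem s a_m 0)%N.
Proof.
apply: leq_trans (cost_for_loopfree _ _ _ _) _ => //.
by rewrite leq_add // [ieval _ _]/= mulnC leq_mul2r orbT.
Qed.

Lemma cost_evaluate s : (cost evaluate s <= 150 + 90 * imem s a_m 0)%N.
Proof.
rewrite !cost_seq.
set c1 := RSet b_t _ _; set c2 := RSet b_h _ _; set c3 := RSet b_val _ _.
have le1 s' : (cost c1 s' <= 20)%N by exact: cost_loopfree_le.
have le2 s' : (cost c2 s' <= 20)%N by exact: cost_loopfree_le.
have le3 s' : (cost c3 s' <= 100)%N by exact: cost_loopfree_le.
have := cost_sum_blocks (run c2 (run c1 s)).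
rewrite (unchanged_run c2 _).1 // (unchanged_run c1 _).1 //.
move: (le1 s) (le2 (run c1 s)) (le3 (run sum_blocks (run c2 (run c1 s)))).
by move: (cost _ _) (cost _ _) (cost _ _) (cost _ _) => x y z t; lia.
Qed.

Lemma cost_find_delta s :
  (cost find_delta s <= 100 + (imem s a_m 0).+1 * (200 + 90 * imem s a_m 0))%N.
Proof.
rewrite cost_seq -[100%N]/(50 + 50)%N -addnA.
apply: leq_add; first exact: cost_loopfree_le.
set s0 := run _ s.
have body_le i s1 : (i < ieval s0 (isucc (ivar a_m)))%N ->
    unchanged (For b_delta (isucc (ivar a_m)) (Seq evaluate keep_best)) s0 s1 ->
    (cost (Seq evaluate keep_best) (iset s1 b_delta 0 i)
     <= 199 + 90 * imem s a_m 0)%N.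
  move=> _ un; set s2 := iset s1 b_delta 0 i; rewrite cost_seq.
  have le2 s' : (cost keep_best s' <= 40)%N by exact: cost_loopfree_le.
  have := cost_evaluate s2.
  have -> : imem s2 a_m 0 = imem s a_m 0.
    rewrite /s2; mem_simpl; rewrite un.1 //; exact: (unchanged_run _ s).1.
  move: (le2 (run evaluate s2)).
  by move: (cost _ _) (cost _ _) => x y; lia.
apply: leq_trans (cost_for_le body_le) _.
have -> : ieval s0 (isucc (ivar a_m)) = (imem s a_m 0).+1 by rewrite /= addn1.
by rewrite leq_add.
Qed.

Lemma cost_write_out s : (cost write_out s <= 10 + 90 * imem s a_m 0)%N.
Proof.
apply: leq_trans (cost_for_loopfree _ _ _ _) _ => //.
by rewrite leq_add // [ieval _ _]/= mulnC leq_mul2r orbT.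
Qed.

(** With [K] the total block width, the phases add up to at most 610 + 90 [K] + 90 n + 580 m + 180
    m^2; since m is at most m^2, every coefficient stays below 1000. *)
Lemma cost_greedy s :
  (cost greedy s
   <= 1000 * (1 + (\sum_(j < imem s a_m 0) (imem s a_k j).-1 + imem s a_n 0
                   + imem s a_m 0 ^ 2)))%N.
Proof.
set m := imem s a_m 0; set s1 := run find_zstar s; set s2 := run sort_gains s1.
set s3 := run compute_dotN s2; set s4 := run find_delta s3.
have -> : cost greedy s = (cost find_zstar s + (cost sort_gains s1 +
    (cost compute_dotN s2 + (cost find_delta s3 + cost write_out s4))))%N by [].
have un1 : unchanged find_zstar s s1 := unchanged_run _ _.
have un2 : unchanged sort_gains s1 s2 := unchanged_run _ _.
have un3 : unchanged compute_dotN s2 s3 := unchanged_run _ _.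
have un4 : unchanged find_delta s3 s4 := unchanged_run _ _.
have m1 : imem s1 a_m 0 = m by rewrite un1.1.
have m3 : imem s3 a_m 0 = m by rewrite un3.1 // un2.1.
have m4 : imem s4 a_m 0 = m by rewrite un4.1.
have n2 : imem s2 a_n 0 = imem s a_n 0 by rewrite un2.1 // un1.1.
have := cost_find_zstar s; rewrite big_split /= sum_nat_const card_ord -big_distrr /=.
have := cost_sort_gains s1; have := cost_compute_dotN s2.
have := cost_find_delta s3; have := cost_write_out s4.
rewrite m1 m3 m4 n2 -/m.
set K := (\sum_(j < m) _)%N.
have lemm : (m <= m ^ 2)%N by case: (m) => // q; rewrite expnS leq_pmulr.
move: lemm; rewrite -mulnn.
move: (cost _ _) (cost _ _) (cost _ _) (cost _ _) (cost _ _) => x1 x2 x3 x4 x5.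
by clearbody m K; lia.
Qed.
End Costs.

Theorem theorem5 :
  exists (alg : cmd) (c : nat),
  forall (R : realType) (N n m : nat) (k : 'I_m -> nat)
    (x : 'I_N -> 'rV[R]_n) (z : 'I_N -> catvec k) (y : 'I_N -> R)
    (p : R) (i : 'I_N)
    (beta0 : R) (betaN : 'rV[R]_n) (betaC : forall j : 'I_m, 'rV[R]_(k j).-1)
    (lambda s_i : R),
  (forall j, (2 <= k j)%N) ->
  (forall i', CC (z i')) ->
  (forall i', y i' = -1 \/ y i' = 1) ->
  0 < p ->
  0 <= lambda ->
  let I := Subproblem (x i) (z i) (y i) beta0 betaN betaC lambda s_i p in
  (forall (zstar : catvec k) (pi : {perm 'I_m}) (zout : catvec k),
     greedy_run I zstar pi zout -> most_violated_in I (@CC m k) zout) /\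
  implements_within alg I (c * maxn 1 (ktot k + n + m ^ 2)).
Proof.
(* The factor 2 turns [1 + X] into a multiple of [maxn 1 X]. *)
exists greedy, (1000 * 2)%N => R N n m k x z y p i beta0 betaN betaC lambda s_i.
move=> k_ge2 CC_z _ _ _ I.
split=> [zstar pi zout|s input]; first exact/greedy_run_optimal/CC_z.
split.
  exists (zstar_out k s), (pi_out m s), (z_out I s).
  split; first exact: greedy_run_out input k_ge2 (CC_z i).
  exact: holds_run_out input k_ge2 (CC_z i).
have kE := imem_k input; have [[nE mE _ _] _ _] := input.
have ktotE : (\sum_(j < imem s a_m 0) (imem s a_k j).-1)%N = ktot k.
  rewrite mE /ktot.
  (* Each [k j] is positive, so neither the predecessors nor the subtraction in [ktot] truncate. *)
  have -> : (\sum_j k j = \sum_(j < m) (k j).-1 + m)%N.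
    transitivity (\sum_(j < m) ((k j).-1 + 1))%N.
      apply: eq_bigr => j _.
      by rewrite addn1 prednK // ltnW // k_ge2.
    by rewrite big_split sum_nat_const card_ord muln1.
  by rewrite addnK; apply: eq_bigr => j _; rewrite kE.
apply: leq_trans (cost_greedy s) _; rewrite ktotE nE mE.
rewrite -mulnA; apply: leq_mul; first exact: leqnn.
by rewrite mul2n -addnn leq_add ?leq_maxl ?leq_maxr.
Qed.
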